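(* For all integers $m\ge 0$ and $k$, we have $$-p^{2}q+V_{2k}^{2}=\Delta U_{2k-1}U_{2k+1}\qquad\text{and}\qquad -qV_{2}^{2}+V_{2k-1}^{2}=\Delta U_{2k-3}U_{2k+1},$$ and, for $n\in\{2m,2m+1\}$, \begin{align*} \delta_{n}+A_{n}^{(2k,2k)}(V)&=\begin{cases}\Delta d_{m}U_{2k+2m+1}U_{2k+2m-1}&\text{if }n=2m,\\-p\Delta c_{m}U_{2k+2m+3}V_{2k+2m-1}&\text{if }n=2m+1,\end{cases}\\ \theta_{n}+A_{n}^{(2k-1,2k-1)}(V)&=\begin{cases}\Delta d_{m}U_{2k+2m-1}^{2}&\text{if }n=2m,\\-p\Delta c_{m}U_{2k+2m+1}V_{2k+2m-1}&\text{if }n=2m+1,\end{cases}\\ \xi_{n}+A_{n}^{(2k-1,2k)}(V)&=\begin{cases}\Delta d_{m}U_{2k+2m-1}U_{2k+2m}&\text{if }n=2m,\\-p\Delta c_{m}U_{2k+2m}V_{2k+2m+1}&\text{if }n=2m+1,\end{cases} \end{align*} where the sequences $(\delta_n)$, $(\theta_n)$, $(\xi_n)$ are defined by \begin{align*} (\delta_{2m},\delta_{2m+1})&=\left(-qV_{2m+1}^{2},\,-pq\Delta U_{4m+4}\right),\\ (\theta_{2m},\theta_{2m+1})&=\left(-2q(1+d_{m}),\,-p^{2}q\Delta c_{m}\right),\\ (\xi_{2m},\xi_{2m+1})&=\left(-pq(1+d_{m}),\,p\Delta c_{m}\right). \end{align*}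
   Context: Let $p,q$ be integers with $p\neq 0$, $q\in\{1,-1\}$, and $\Delta:=p^2-4q\neq 0$. The sequences $(U_n)_{n\in\mathbb{Z}}$ and $(V_n)_{n\in\mathbb{Z}}$ are defined by $U_0=0$, $U_1=1$, $V_0=2$, $V_1=p$ and the recurrences $U_n=pU_{n-1}-qU_{n-2}$, $V_n=pV_{n-1}-qV_{n-2}$ for all $n\in\mathbb{Z}$ (so they are extended to negative indices by the recurrence). Under these assumptions $U_2$, $V_2$ and $U_4$ are nonzero. For $n\in\mathbb{Z}$ define $c_n=\frac{U_{4n+4}}{U_4}$ and $d_n=\frac{V_{4n+2}}{V_2}$. For integers $r,s$ and $n\ge0$, set $A_n^{(r,s)}(V)=\sum_{i=0}^{n}(-1)^iV_{r+2i}V_{s+2i}$. *)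

(* Defs.v *)
From mathcomp Require Import all_boot all_order all_algebra.
From mathcomp Require Import zify ring.
Set Implicit Arguments.
Unset Strict Implicit.
Unset Printing Implicit Defensive.
Import GRing.Theory.
Local Open Scope ring_scope.

Definition disc (p q : int) : int := p ^+ 2 - 4 * q.

Definition lucas_seq (p q a b : int) (W : int -> int) : Prop :=
  [/\ W 0 = a, W 1 = b & forall n : int, W n = p * W (n - 1) - q * W (n - 2)].

(* Two-sided integer solutions exist because q is invertible in int. *)
Lemma lucas_seq_ex (p q a b : int) :
  q = 1 \/ q = -1 -> exists W, lucas_seq p q a b W.
Proof.
move=> hq; have qq : q * q = 1 by case: hq => ->.
pose f (x : int * int) := (x.2, p * x.2 - q * x.1).
pose g (x : int * int) := (q * (p * x.1 - x.2), x.1).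
pose W (n : int) := match n with
  | Posz n => (iter n f (a, b)).1
  | Negz n => (iter n.+1 g (a, b)).1 end.
exists W; split=> // -[[|[|n]]|n].
- have -> : W (0 - 1) = q * (p * a - b) by [].
  have -> : W (0 - 2) = q * (p * (q * (p * a - b)) - a) by [].
  have -> : W (Posz 0) = a by [].
  by rewrite [q * (q * _)]mulrA qq mul1r; ring.
- have -> : W (Posz 1 - 1) = a by [].
  have -> : W (Posz 1 - 2) = q * (p * a - b) by [].
  have -> : W (Posz 1) = b by [].
  by rewrite mulrA qq mul1r; ring.
- have -> : Posz n.+2 - 1 = Posz n.+1 by lia.
  by have -> : Posz n.+2 - 2 = Posz n by lia.
have -> : Negz n - 1 = Negz n.+1 by lia.
have -> : Negz n - 2 = Negz n.+2 by lia.
rewrite /W !iterS; case: (iter n g (a, b)) => x y /=.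
by rewrite [q * (q * _)]mulrA qq mul1r; ring.
Qed.

Definition c (U : int -> int) (n : int) : rat := (U (4 * n + 4))%:Q / (U 4)%:Q.

Definition d (V : int -> int) (n : int) : rat := (V (4 * n + 2))%:Q / (V 2)%:Q.

Definition A (V : int -> int) (r s : int) (n : nat) : int :=
  \sum_(0 <= i < n.+1) (-1) ^+ i * V (r + 2 * i%:Z) * V (s + 2 * i%:Z).

Definition delta (p q : int) (U V : int -> int) (n : nat) : rat :=
  let m := (n./2)%:Z in
  if odd n then (- p * q * disc p q * U (4 * m + 4))%:Q
  else (- q * V (2 * m + 1) ^+ 2)%:Q.

Definition theta (p q : int) (U V : int -> int) (n : nat) : rat :=
  let m := (n./2)%:Z in
  if odd n then (- p ^+ 2 * q * disc p q)%:Q * c U m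
  else (- 2 * q)%:Q * (1 + d V m).

Definition xi (p q : int) (U V : int -> int) (n : nat) : rat :=
  let m := (n./2)%:Z in
  if odd n then (p * disc p q)%:Q * c U m
  else (- p * q)%:Q * (1 + d V m).

(* Main.v *)
Require Import Defs.
From mathcomp Require Import all_boot all_order all_algebra.
From mathcomp Require Import zify ring.
Import GRing.Theory.
Local Open Scope ring_scope.

(** Everything reduces to the product-to-sum formulas of Lucas sequences,
      [W a * V b = W (a + b) + q ^ b * W (a - b)] for [W = U] and [W = V], and
      [disc p q * U a * U b = V (a + b) - q ^ b * V (a - b)],
    which hold because, for fixed [a], both sides obey the recurrence in [b]
    and agree at [b = 0] and [b = 1].

    The first one turns [V (r + 2i) * V (s + 2i)] into [V (r + s + 4i)] plus
    the constant [q ^ s * V (r - s)].  In the alternating sum the constants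
    survive once for an even last index and cancel for an odd one.  The main
    part telescopes after multiplication by [V 2], since
    [V 2 * V x = V (x + 2) + V (x - 2)]; the two remaining boundary terms are
    recombined by the product formulas into [V (4m+2) * V (r+s+4m)], or into
    [- disc p q * U (r+s+4m+2) * U (4m+4)].  Division by [V 2], together with
    [U 4 = p * V 2], gives the closed forms [alternating_sum_even] and
    [alternating_sum_odd], where [d] and [c] appear.

    The offsets [delta], [theta] and [xi] cancel the surviving constant, if
    there is one; what is left of them is [d V m], or [- p * disc p q * c U m],
    times the second term of a last product formula, whose left side is the
    claimed product.  They depend on [m] alone because the difference of the
    indices in that formula is one of [-1], [0], [2], [4].  The two identities
    without a sum compare the formulas for a square of [V] and for a product
    of values of [U] with the same sum of indices. *)

(** * Sequences obeying the recurrence on both sides *)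

(** The recurrence without initial values, because the formula for
    [W a * V b] is linear in [W] and is needed for both [U] and [V]. *)
Definition lucas_rec (p q : int) (W : int -> int) : Prop :=
  forall n : int, W n = p * W (n - 1) - q * W (n - 2).

Lemma lucas_seq_rec {p q a b : int} {W : int -> int} :
  lucas_seq p q a b W -> lucas_rec p q W.
Proof. by case. Qed.

Lemma lucas_recS {p q : int} {W : int -> int} (n : int) :
  lucas_rec p q W -> W (n + 1) = p * W n - q * W (n - 1).
Proof.
move=> hW; rewrite hW.
by congr (_ * W _ - _ * W _); ring.
Qed.

(** The recurrence can be run backwards because [q] is its own inverse. *)
Lemma lucas_rec_pred {p q : int} {W : int -> int} (n : int) :
  q ^+ 2 = 1 -> lucas_rec p q W -> W (n - 1) = q * (p * W n - W (n + 1)).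
Proof.
move=> q2 hW; rewrite (lucas_recS n hW).
have -> : q * (p * W n - (p * W n - q * W (n - 1))) = q ^+ 2 * W (n - 1).
  by ring.
by rewrite q2 mul1r.
Qed.

Lemma lucas_rec_unique {p q : int} {W W' : int -> int} :
  q ^+ 2 = 1 -> lucas_rec p q W -> lucas_rec p q W' ->
  W 0 = W' 0 -> W 1 = W' 1 -> forall n, W n = W' n.
Proof.
move=> q2 hW hW' e0 e1.
have pos (n : nat) : W n%:Z = W' n%:Z /\ W (n%:Z + 1) = W' (n%:Z + 1).
  elim: n => [|n [IH1 IH2]]; first by [].
  have -> : n.+1%:Z = n%:Z + 1 by lia.
  split=> //; rewrite (lucas_recS _ hW) (lucas_recS _ hW').
  by rewrite (_ : n%:Z + 1 - 1 = n%:Z) ?IH1 ?IH2 //; ring.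
have neg (n : nat) : W (- n%:Z) = W' (- n%:Z) /\ W (1 - n%:Z) = W' (1 - n%:Z).
  elim: n => [|n [IH1 IH2]]; first by [].
  have -> : 1 - n.+1%:Z = - n%:Z by lia.
  have -> : - n.+1%:Z = - n%:Z - 1 by lia.
  split=> //; rewrite (lucas_rec_pred _ q2 hW) (lucas_rec_pred _ q2 hW').
  by rewrite (addrC (- n%:Z)) IH1 IH2.
case=> n; first exact: (pos n).1.
by rewrite NegzE; exact: (neg n.+1).1.
Qed.

(** * Integer powers of a sign *)

Lemma sign_exprz_double {q : int} (b : int) : q ^+ 2 = 1 -> q ^ (2 * b) = 1.
Proof. by move=> q2; rewrite -exprz_exp [q ^ 2]q2 exp1rz. Qed.

Lemma sign_exprzS {q : int} (b : int) : q ^+ 2 = 1 -> q ^ (b + 1) = q ^ b * q.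
Proof.
move=> q2; rewrite exprzDr ?expr1z //.
by apply/unitrP; exists q; rewrite -expr2 q2.
Qed.

Lemma sign_exprz_even_shift {q : int} (s : int) (j : int) :
  q ^+ 2 = 1 -> q ^ (s + 2 * j) = q ^ s.
Proof.
move=> q2; rewrite exprzDr ?sign_exprz_double ?mulr1 //.
by apply/unitrP; exists q; rewrite -expr2 q2.
Qed.

Lemma sign_exprz_odd {q : int} (j : int) : q ^+ 2 = 1 -> q ^ (2 * j + 1) = q.
Proof. by move=> q2; rewrite sign_exprzS // sign_exprz_double // mul1r. Qed.

(** * Product-to-sum formulas *)

(** The reflection [W (a - b)] obeys the recurrence with [p] replaced by
    [p * q], the recurrence of the inverse roots; the factor [q ^ b] turns it
    back into the original one. *)
Lemma lucas_rec_reflect {p q : int} {W : int -> int} (a : int) :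
  q ^+ 2 = 1 -> lucas_rec p q W ->
  lucas_rec p q (fun b => q ^ b * W (a - b)).
Proof.
move=> q2 hW n.
have -> : q ^ n = q ^ (n - 2).
  have -> : n = n - 2 + 1 + 1 by ring.
  rewrite 2!(sign_exprzS _ q2) -mulrA -expr2 q2 mulr1; congr (q ^ _); ring.
have -> : q ^ (n - 1) = q ^ (n - 2) * q.
  by rewrite -(sign_exprzS _ q2); congr (q ^ _); ring.
have e1 : a - (n - 1) = a - n + 1 by ring.
have e2 : a - (n - 2) = a - n + 1 + 1 by ring.
rewrite e1 e2 (lucas_recS (a - n + 1) hW).
rewrite (_ : a - n + 1 - 1 = a - n); last by ring.
(* The terms in [W (a - n + 1)] cancel; the rest differs by [q ^+ 2 = 1]. *)
transitivity (q ^ (n - 2) * (q ^+ 2 * W (a - n))); first by rewrite q2 mul1r.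
by ring.
Qed.

Lemma lucas_rec_shift {p q : int} {W : int -> int} (a : int) :
  lucas_rec p q W -> lucas_rec p q (fun b => W (a + b)).
Proof.
move=> hW n /=; rewrite (hW (a + n)).
by rewrite !addrA.
Qed.

Lemma lucas_mulV {p q : int} {V W : int -> int} (a b : int) :
  q ^+ 2 = 1 -> lucas_seq p q 2 p V -> lucas_rec p q W ->
  W a * V b = W (a + b) + q ^ b * W (a - b).
Proof.
move=> q2 [V0 V1 hV] hW.
have hR := lucas_rec_reflect a q2 hW; have hS := lucas_rec_shift a hW.
apply: (lucas_rec_unique (p := p) q2 (W := fun b => W a * V b)
  (W' := fun b => W (a + b) + q ^ b * W (a - b))) => [n|n||] /=.
- by rewrite (hV n); ring.
- rewrite (hR n) (hS n).
  by move: (_ * W _) (_ * W _) (W _) (W _) => x y z t; ring.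
- by rewrite V0 expr0z ?subr0 ?addr0; ring.
- by rewrite V1 expr1z (lucas_recS a hW); ring.
Qed.

(** The case [b = 1] of [disc_mulUU], which its proof by uniqueness in [b]
    needs as an initial value; it is itself proved by uniqueness in [a]. *)
Lemma disc_mulU {p q : int} {U V : int -> int} (a : int) :
  q ^+ 2 = 1 -> lucas_seq p q 0 1 U -> lucas_seq p q 2 p V ->
  disc p q * U a = V (a + 1) - q * V (a - 1).
Proof.
move=> q2 [U0 U1 hU] [V0 V1 hV].
apply: (lucas_rec_unique (p := p) q2 (W := fun a => disc p q * U a)
  (W' := fun a => V (a + 1) - q * V (a - 1))) => [n|n||] /=.
- by rewrite (hU n); ring.
- rewrite (hV (n + 1)) (hV (n - 1)).
  rewrite !(addrAC n _ 1) !(addrAC n _ (-1)).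
  by ring.
- have -> : V (0 - 1) = q * (p * V 0 - V (0 + 1)) by exact: lucas_rec_pred.
  rewrite U0 add0r V0 V1 mulr0.
  transitivity (p - q ^+ 2 * p); last by ring.
  by rewrite q2 mul1r subrr.
- by rewrite U1 (lucas_recS 1 hV) subrr V0 V1 /disc; ring.
Qed.

Lemma disc_mulUU {p q : int} {U V : int -> int} (a b : int) :
  q ^+ 2 = 1 -> lucas_seq p q 0 1 U -> lucas_seq p q 2 p V ->
  disc p q * U a * U b = V (a + b) - q ^ b * V (a - b).
Proof.
move=> q2 hU0 hV0; have [U0 U1 hU] := hU0; have [V0 V1 hV] := hV0.
have hR := lucas_rec_reflect a q2 hV; have hS := lucas_rec_shift a hV.
apply: (lucas_rec_unique (p := p) q2 (W := fun b => disc p q * U a * U b)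
  (W' := fun b => V (a + b) - q ^ b * V (a - b))) => [n|n||] /=.
- by rewrite (hU n); ring.
- rewrite (hR n) (hS n).
  by move: (_ * V _) (_ * V _) (V _) (V _) => x y z t; ring.
- by rewrite U0 expr0z ?subr0 ?addr0; ring.
- by rewrite U1 expr1z mulr1; apply: disc_mulU.
Qed.

(** The sum and the difference of the indices are parameters, tied by
    equations, so that an instance can be given in the normal form in which
    it is used; the parity of [b] resolves the power of [q]. *)
Lemma lucas_mulV_even {p q : int} {V W : int -> int} (a b x y : int) (j : int) :
  q ^+ 2 = 1 -> lucas_seq p q 2 p V -> lucas_rec p q W ->
  b = 2 * j -> a + b = x -> a - b = y -> W a * V b = W x + W y.
Proof.
move=> q2 hV hW bE <- <-; rewrite (lucas_mulV _ _ q2 hV hW).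
by rewrite {2}bE sign_exprz_double // mul1r.
Qed.

Lemma lucas_mulV_odd {p q : int} {V W : int -> int} (a b x y : int) (j : int) :
  q ^+ 2 = 1 -> lucas_seq p q 2 p V -> lucas_rec p q W ->
  b = 2 * j + 1 -> a + b = x -> a - b = y -> W a * V b = W x + q * W y.
Proof.
move=> q2 hV hW bE <- <-; rewrite (lucas_mulV _ _ q2 hV hW).
by rewrite {2}bE sign_exprz_odd.
Qed.

Lemma disc_mulUU_even {p q : int} {U V : int -> int} (a b x y : int) (j : int) :
  q ^+ 2 = 1 -> lucas_seq p q 0 1 U -> lucas_seq p q 2 p V ->
  b = 2 * j -> a + b = x -> a - b = y -> disc p q * U a * U b = V x - V y.
Proof.
move=> q2 hU hV bE <- <-; rewrite (disc_mulUU _ _ q2 hU hV).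
by rewrite {2}bE sign_exprz_double // mul1r.
Qed.

Lemma disc_mulUU_odd {p q : int} {U V : int -> int} (a b x y : int) (j : int) :
  q ^+ 2 = 1 -> lucas_seq p q 0 1 U -> lucas_seq p q 2 p V ->
  b = 2 * j + 1 -> a + b = x -> a - b = y ->
  disc p q * U a * U b = V x - q * V y.
Proof.
move=> q2 hU hV bE <- <-; rewrite (disc_mulUU _ _ q2 hU hV).
by rewrite {2}bE sign_exprz_odd.
Qed.

(** * The alternating sum *)

(** Multiplied by [V 2], the term of index [i] is, up to its sign and its
    constant part, [V (r + s + 4i + 2) + V (r + s + 4i - 2)], so that the sum
    telescopes and the constants cancel in pairs. *)
Lemma V2_mul_alternating_sum {p q : int} {V : int -> int}
    (r s : int) (n : nat) :
  q ^+ 2 = 1 -> lucas_seq p q 2 p V ->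
  V 2 * A V r s n
  = V (r + s - 2) + (-1) ^+ n * V (r + s + 4 * n%:Z + 2)
    + (~~ odd n)%:R * (V 2 * (q ^ s * V (r - s))).
Proof.
move=> q2 hV.
have term (i : nat) :
    V 2 * (V (r + 2 * i%:Z) * V (s + 2 * i%:Z))
    = V (r + s + 4 * i%:Z + 2) + V (r + s + 4 * i%:Z - 2)
      + V 2 * (q ^ s * V (r - s)).
  rewrite (lucas_mulV _ _ q2 hV (lucas_seq_rec hV)) sign_exprz_even_shift //.
  rewrite (_ : r + 2 * i%:Z + (s + 2 * i%:Z) = r + s + 4 * i%:Z); last by ring.
  rewrite (_ : r + 2 * i%:Z - (s + 2 * i%:Z) = r - s); last by ring.
  rewrite mulrDr [V 2 * V _]mulrC.
  have hVr := lucas_seq_rec hV.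
  by rewrite (lucas_mulV_even _ _ _ _ 1 q2 hV hVr erefl erefl erefl).
elim: n => [|n IH].
  rewrite /A big_nat1 -mulrA mul1r term expr0 /= !mulr0 !addr0.
  by rewrite mul1r [in RHS](addrC (V _) (V _)) mul1r.
rewrite /A big_nat_recr //= mulrDr -/(A V r s n) IH exprS.
have -> : forall e x y z : int, x * (e * y * z) = e * (x * (y * z)).
  by move=> *; ring.
rewrite term.
rewrite (_ : r + s + 4 * n.+1%:Z - 2 = r + s + 4 * n%:Z + 2); last by lia.
by rewrite -signr_odd; case: (odd n) => /=; ring.
Qed.

Lemma lucas_V2 {p q : int} {V : int -> int} :
  lucas_seq p q 2 p V -> V 2 = p ^+ 2 - 2 * q.
Proof.
move=> [V0 V1 hV]; rewrite (lucas_recS 1 hV) subrr V0 V1; ring.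
Qed.

(** [p ^+ 2 = 2 * q] is impossible because [2] and [-2] are not squares. *)
Lemma lucas_V2_neq0 {p q : int} {V : int -> int} :
  q = 1 \/ q = -1 -> lucas_seq p q 2 p V -> V 2 != 0.
Proof.
move=> hq hV; rewrite (lucas_V2 hV).
apply/eqP => h.
have h1 : p * p = 2 * q by move: h; rewrite expr2; lia.
have hp : (p <= -2) || (p == -1) || (p == 0) || (p == 1) || (2 <= p) by lia.
by move: hp => /orP[/orP[/orP[/orP[hp|/eqP hp]|/eqP hp]|/eqP hp]|hp];
  subst; case: hq h1 => -> h1; nia.
Qed.

Lemma lucas_U4 {p q : int} {U V : int -> int} :
  lucas_seq p q 0 1 U -> lucas_seq p q 2 p V -> U 4 = p * V 2.
Proof.
move=> [U0 U1 hU] hV; rewrite (lucas_V2 hV).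
have U2 : U 2 = p by rewrite (lucas_recS 1 hU) subrr U0 U1; ring.
have U3 : U 3 = p ^+ 2 - q.
  by rewrite (lucas_recS 2 hU) U2 [2 - 1]/(1 : int) U1; ring.
by rewrite (lucas_recS 3 hU) U3 [3 - 1]/(2 : int) U2; ring.
Qed.

(** The boundary terms add up to [V (r + s + 4m) * V (4m + 2)], by the
    formula for [V a * V b] read backwards with an even [b]. *)
Lemma alternating_sum_even {p q : int} {V : int -> int} (r s : int) (m : nat) :
  q = 1 \/ q = -1 -> lucas_seq p q 2 p V ->
  (A V r s (2 * m)%N)%:Q
  = d V m%:Z * (V (r + s + 4 * m%:Z))%:Q + (q ^ s * V (r - s))%:Q.
Proof.
move=> hq hV; have q2 : q ^+ 2 = 1 by case: hq => ->.
have V2n0 : (V 2)%:Q != 0 by rewrite intr_eq0 (lucas_V2_neq0 hq hV).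
have h := V2_mul_alternating_sum r s (2 * m)%N q2 hV.
have e : V (r + s + 4 * m%:Z) * V (4 * m%:Z + 2)
         = V (r + s + 4 * (2 * m)%N%:Z + 2) + V (r + s - 2).
  by apply: (lucas_mulV_even _ _ _ _ (2 * m%:Z + 1) q2 hV (lucas_seq_rec hV));
    rewrite ?PoszM; ring.
move: h; rewrite oddM /= exprM sqrrN !expr1n !mul1r [V _ + V _]addrC -e.
move/(congr1 (fun z : int => z%:Q)).
rewrite intrD !intrM => h; apply: (mulfI V2n0).
by rewrite h /d; field.
Qed.

(** The boundary terms now have opposite signs, which calls for the formula
    for [disc p q * U a * U b]; the factor [p] comes from [U 4 = p * V 2],
    [c] being normalised by [U 4]. *)
Lemma alternating_sum_odd {p q : int} {U V : int -> int} (r s : int) (m : nat) :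
  p != 0 -> q = 1 \/ q = -1 -> lucas_seq p q 0 1 U -> lucas_seq p q 2 p V ->
  (A V r s (2 * m + 1)%N)%:Q
  = - (p * disc p q)%:Q * c U m%:Z * (U (r + s + 4 * m%:Z + 2))%:Q.
Proof.
move=> hp hq hU hV; have q2 : q ^+ 2 = 1 by case: hq => ->.
have V2n0 : (V 2)%:Q != 0 by rewrite intr_eq0 (lucas_V2_neq0 hq hV).
have pn0 : p%:Q != 0 by rewrite intr_eq0.
have h := V2_mul_alternating_sum r s (2 * m + 1)%N q2 hV.
have e : disc p q * U (r + s + 4 * m%:Z + 2) * U (4 * m%:Z + 4)
         = V (r + s + 4 * (2 * m + 1)%N%:Z + 2) - V (r + s - 2).
  by apply: (disc_mulUU_even _ _ _ _ (2 * m%:Z + 2) q2 hU hV);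
    rewrite ?PoszD ?PoszM; ring.
move: h; rewrite oddD oddM /= exprD exprM sqrrN !expr1n mul1r expr1 mul0r addr0.
rewrite mulN1r -opprB -e.
move/(congr1 (fun z : int => z%:Q)).
rewrite intrN !intrM => h; apply: (mulfI V2n0).
rewrite h /c (lucas_U4 hU hV) !intrM; field.
by rewrite V2n0.
Qed.

(** * The closed forms *)

Theorem theorem6 (p q : int) (U V : int -> int)
  (hp : p != 0) (hq : q = 1 \/ q = -1) (hD : disc p q != 0)
  (hU : lucas_seq p q 0 1 U) (hV : lucas_seq p q 2 p V)
  (m : nat) (k : int) :
  (- p ^+ 2 * q + V (2 * k) ^+ 2
     = disc p q * U (2 * k - 1) * U (2 * k + 1)) /\
  (- q * V 2 ^+ 2 + V (2 * k - 1) ^+ 2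
     = disc p q * U (2 * k - 3) * U (2 * k + 1)) /\
  (delta p q U V (2 * m)%N + (A V (2 * k) (2 * k) (2 * m)%N)%:Q
     = (disc p q)%:Q * d V m%:Z
       * (U (2 * k + 2 * m%:Z + 1) * U (2 * k + 2 * m%:Z - 1))%:Q) /\
  (delta p q U V (2 * m + 1)%N + (A V (2 * k) (2 * k) (2 * m + 1)%N)%:Q
     = - (p * disc p q)%:Q * c U m%:Z
       * (U (2 * k + 2 * m%:Z + 3) * V (2 * k + 2 * m%:Z - 1))%:Q) /\
  (theta p q U V (2 * m)%N + (A V (2 * k - 1) (2 * k - 1) (2 * m)%N)%:Q
     = (disc p q)%:Q * d V m%:Z * (U (2 * k + 2 * m%:Z - 1) ^+ 2)%:Q) /\
  (theta p q U V (2 * m + 1)%N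
     + (A V (2 * k - 1) (2 * k - 1) (2 * m + 1)%N)%:Q
     = - (p * disc p q)%:Q * c U m%:Z
       * (U (2 * k + 2 * m%:Z + 1) * V (2 * k + 2 * m%:Z - 1))%:Q) /\
  (xi p q U V (2 * m)%N + (A V (2 * k - 1) (2 * k) (2 * m)%N)%:Q
     = (disc p q)%:Q * d V m%:Z
       * (U (2 * k + 2 * m%:Z - 1) * U (2 * k + 2 * m%:Z))%:Q) /\
  (xi p q U V (2 * m + 1)%N + (A V (2 * k - 1) (2 * k) (2 * m + 1)%N)%:Q
     = - (p * disc p q)%:Q * c U m%:Z
       * (U (2 * k + 2 * m%:Z) * V (2 * k + 2 * m%:Z + 1))%:Q).
Proof.
have q2 : q ^+ 2 = 1 by case: hq => ->.
have hVr := lucas_seq_rec hV; have hUr := lucas_seq_rec hU.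
have [U0 U1 _] := hU; have [V0 V1 _] := hV.
have V2 := lucas_V2 hV.
have V2n0 : (V 2)%:Q != 0 by rewrite intr_eq0 (lucas_V2_neq0 hq hV).
have pn0 : p%:Q != 0 by rewrite intr_eq0.
have U2 : U 2 = p by rewrite (lucas_recS 1 hUr) subrr U0 U1; ring.
have V4 : V 4 = V 2 ^+ 2 - 2.
  by rewrite expr2 (lucas_mulV_even _ _ 4 0 1 q2 hV hVr) // V0 addrK.
have V_N1 : V (-1) = q * p.
  by have := lucas_rec_pred 0 q2 hVr; rewrite sub0r add0r V0 V1 => ->; ring.
have U_N1 : U (-1) = - q.
  by have := lucas_rec_pred 0 q2 hUr; rewrite sub0r add0r U0 U1 => ->; ring.
have qo : q ^ (2 * k - 1) = q.
  rewrite (_ : 2 * k - 1 = 2 * (k - 1) + 1); last by ring.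
  exact: sign_exprz_odd.
have he : (2 * m)./2 = m by rewrite mul2n doubleK.
have ho : (2 * m + 1)./2 = m by rewrite addn1 mul2n /= uphalf_double.
have oe : odd (2 * m) = false by rewrite oddM.
have oo : odd (2 * m + 1) by rewrite oddD oe.
have dV2 : (V (4 * m%:Z + 2))%:Q = d V m%:Z * (V 2)%:Q by rewrite divfK.
have cU4 : (U (4 * m%:Z + 4))%:Q = c U m%:Z * (p * V 2)%:Q.
  by rewrite -(lucas_U4 hU hV) divfK // (lucas_U4 hU hV) intrM mulf_neq0.
have sumE r s := alternating_sum_even r s m hq hV.
have sumO r s := alternating_sum_odd r s m hp hq hU hV.
rewrite /delta /theta /xi he ho oe oo !sumE !sumO !subrr V0 qo.
rewrite sign_exprz_double // (_ : 2 * k - 1 - 2 * k = -1); last by ring.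
rewrite V_N1.
have DdUU a b : (disc p q)%:Q * d V m%:Z * (U a * U b)%:Q
    = d V m%:Z * (disc p q * U a * U b)%:Q by rewrite !intrM; ring.
(* This makes [delta] at an even index linear in [d V m], like the others. *)
have V2q : q * V (2 * m%:Z + 1) ^+ 2 = q * V (4 * m%:Z + 2) + 2.
  rewrite expr2 (lucas_mulV_odd _ _ (4 * m%:Z + 2) 0 m%:Z q2 hV hVr) //; try ring.
  by rewrite V0 mulrDr mulrA -expr2 q2 mul1r.
(* The numeral in each instance is the difference of the two indices; the term
   at that index is what the summands free of [k] on the left account for. *)
do ![split].
- rewrite mulrAC (disc_mulUU_odd _ _ (4 * k) 2 (k - 1) q2 hU hV); try ring.
  rewrite [V _ ^+ 2]expr2.
  rewrite (lucas_mulV_even _ _ (4 * k) 0 k q2 hV hVr) //; try ring.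
  rewrite V0 V2.
  transitivity (V (4 * k) - p ^+ 2 * q + 2 * q ^+ 2); last by ring.
  by rewrite q2; ring.
- rewrite mulrAC (disc_mulUU_odd _ _ (4 * k - 2) 4 (k - 2) q2 hU hV); try ring.
  rewrite [V (_ - _) ^+ 2]expr2.
  rewrite (lucas_mulV_odd _ _ (4 * k - 2) 0 (k - 1) q2 hV hVr) //; try ring.
  by rewrite V0 V4; ring.
- rewrite DdUU (disc_mulUU_odd _ _ (2 * k + 2 * k + 4 * m%:Z) 2 (k + m%:Z - 1)
    q2 hU hV); try ring.
  by rewrite mulNr V2q !(intrD, intrN, intrM) dV2; ring.
- rewrite (lucas_mulV_odd _ _ (2 * k + 2 * k + 4 * m%:Z + 2) 4 (k + m%:Z - 1)
    q2 hV hUr); try ring.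
  by rewrite (lucas_U4 hU hV) !(intrD, intrN, intrM) cU4 intrM; ring.
- rewrite [U _ ^+ 2]expr2 DdUU.
  rewrite (disc_mulUU_odd _ _ (2 * k - 1 + (2 * k - 1) + 4 * m%:Z) 0
    (k + m%:Z - 1) q2 hU hV); try ring.
  by rewrite V0 !(intrD, intrN, intrM); ring.
- rewrite (lucas_mulV_odd _ _ (2 * k - 1 + (2 * k - 1) + 4 * m%:Z + 2) 2
    (k + m%:Z - 1) q2 hV hUr); try ring.
  by rewrite U2 !(intrD, intrN, intrM); ring.
- rewrite DdUU (disc_mulUU_even _ _ (2 * k - 1 + 2 * k + 4 * m%:Z) (-1) (k + m%:Z)
    q2 hU hV); try ring.
  by rewrite V_N1 !(intrD, intrN, intrM); ring.
- rewrite (lucas_mulV_odd _ _ (2 * k - 1 + 2 * k + 4 * m%:Z + 2) (-1) (k + m%:Z)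
    q2 hV hUr); try ring.
  by rewrite U_N1 mulrN -expr2 q2 !(intrD, intrN, intrM); ring.
Qed.
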